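(* Let $d,d'\ge1$ and let $f:\mathrm{dom}\,X\to\mathrm{dom}\,X'$ be a map satisfying the scaling condition such that the induced map $F:\mathbb{R}^d\to\mathbb{R}^{d'}$ is strict inversely convexity preserving. Let $\mathcal{S}$ be a trajectory set (with $d+1$ assets), $\mathbf{S}\in\mathcal{S}$ and $k\ge0$. If the node $(\mathbf{S},k)$ is arbitrage-free, then the transformed node $(\mathbf{S}',k)$, where $S'_i=f(S_i)$ for $i\ge0$, is arbitrage-free, i.e. $$0\in\mathrm{ri}\Big(\mathrm{co}\big(\{X'(f(\hat S_{k+1}))-X'(f(S_k)):\hat{\mathbf{S}}\in\mathcal{S}_{(\mathbf{S},k)}\}\big)\Big)\subseteq\mathbb{R}^{d'},$$ and so $f$ is a no-arbitrage symmetry.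
   Context: Coordinates of $s\in\mathbb{R}^{d+1}$ are $s=(s^0,\dots,s^d)$. The perspective function is $X(s)=(s^1/s^0,\dots,s^d/s^0)$ on $\mathrm{dom}\,X=\{s\in\mathbb{R}^{d+1}:s^0>0\}$; $X'$ is the analogous function on $\mathrm{dom}\,X'=\{s\in\mathbb{R}^{d'+1}:s^0>0\}$ with values in $\mathbb{R}^{d'}$. Scaling condition: for every $s\in\mathrm{dom}\,X$ and $\lambda>0$ there is $\mu_{\lambda,s}>0$ with $f(\lambda s)=\mu_{\lambda,s}f(s)$. Under it there is a unique $F:\mathbb{R}^d\to\mathbb{R}^{d'}$ with $F(X(s))=X'(f(s))$ for all $s\in\mathrm{dom}\,X$, called the map induced by $f$. With $(x,y)=\{tx+(1-t)y:0<t<1\}$, a map $g:C\to\mathbb{R}^{d'}$ on a convex set $C\subseteq\mathbb{R}^d$ is strict inversely convexity preserving if $g((x,y))\subseteq(g(x),g(y))$ for all $x,y\in C$. Trajectory set: given subsets $\Sigma_i\subseteq\mathbb{R}^{d+1}$, sets $\Omega_i$ ($i\ge0$), $\Theta\subseteq\mathbb{N}$, $s_0\in\mathbb{R}^{d+1}$, $w_0\in\Omega_0$, a trajectory set $\mathcal{S}$ is a set of sequences $\mathbf{S}=\{\mathbf{S}_i=(S_i,W_i,m)\}_{i\ge0}$ with $S_i\in\Sigma_i$, $W_i\in\Omega_i$, $m\in\Theta$, $(S_0,W_0)=(s_0,w_0)$; it is assumed throughout that $S^0_i>0$ for all $i$. Put $M(\mathbf{S})=m$. A node is a pair $(\mathbf{S},k)$,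 and $\mathcal{S}_{(\mathbf{S},k)}=\{\mathbf{S}'\in\mathcal{S}:\mathbf{S}'_i=\mathbf{S}_i,\ 0\le i\le k,\ M(\mathbf{S}')>k\}$. The node $(\mathbf{S},k)$ is arbitrage-free if $0\in\mathrm{ri}(\mathrm{co}(\{X(\hat S_{k+1})-X(S_k):\hat{\mathbf{S}}\in\mathcal{S}_{(\mathbf{S},k)}\}))$, where $\mathrm{co}$ is convex hull and $\mathrm{ri}$ relative interior. A no-arbitrage symmetry is a map $f$ carrying arbitrage-free nodes to arbitrage-free nodes in the sense of the display in the claim (the components $W,m$ play no role). *)

(* Defs.v *)
From HB Require Import structures.
From mathcomp Require Import all_boot all_order all_algebra.
From mathcomp Require Import all_classical all_reals all_analysis.

Set Implicit Arguments.
Unset Strict Implicit.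
Unset Printing Implicit Defensive.

Import Order.TTheory GRing.Theory Num.Theory.
Import numFieldNormedType.Exports.

Local Open Scope classical_set_scope.
Local Open Scope ring_scope.

Section convexity.
Context {R : realType} {n : nat}.
Implicit Types (A : set 'rV[R]_n) (x y : 'rV[R]_n).

Definition convex_hull A : set 'rV[R]_n :=
  smallest (fun B : set 'rV[R]_n => convex_set B) A.

Definition affine_set A :=
  forall x y (t : R), A x -> A y -> A (t *: x + (1 - t) *: y).

Definition affine_hull A : set 'rV[R]_n := smallest affine_set A.

(* The topology on 'rV[R]_n comes from the sup norm, hence is the Euclidean
   one. *)
Definition relative_interior A : set 'rV[R]_n :=
  [set x | affine_hull A x /\ \forall y \near x, affine_hull A y -> A y].

(* When x = y this is the singleton [set x]. *)
Definition open_segment x y : set 'rV[R]_n :=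
  [set t *: x + (1 - t) *: y | t in [set t : R | 0 < t < 1]].

End convexity.

(* C is meant to be convex. *)
Definition strict_inversely_convexity_preserving {R : realType} {n n' : nat}
    (C : set 'rV[R]_n) (g : 'rV[R]_n -> 'rV[R]_n') :=
  forall x y, C x -> C y ->
    g @` open_segment x y `<=` open_segment (g x) (g y).

Section perspective.
Context {R : realType}.

Definition dom_persp {d : nat} : set 'rV[R]_d.+1 :=
  [set s | 0 < s ord0 ord0].

Definition persp {d : nat} (s : 'rV[R]_d.+1) : 'rV[R]_d :=
  \row_j (s ord0 (lift ord0 j) / s ord0 ord0).

(* In the definitions below, only the values of f on dom_persp matter. *)
Definition scaling_condition {d d' : nat}
    (f : 'rV[R]_d.+1 -> 'rV[R]_d'.+1) :=
  forall s (lambda : R), dom_persp s -> 0 < lambda ->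
    exists2 mu : R, 0 < mu & f (lambda *: s) = mu *: f s.

Definition induces {d d' : nat} (f : 'rV[R]_d.+1 -> 'rV[R]_d'.+1)
    (F : 'rV[R]_d -> 'rV[R]_d') :=
  forall s, dom_persp s -> F (persp s) = persp (f s).

Lemma ex_unique_induced (d d' : nat) (f : 'rV[R]_d.+1 -> 'rV[R]_d'.+1) :
  scaling_condition f -> exists! F, induces f F.
Proof.
move=> scf; pose e (x : 'rV[R]_d) : 'rV[R]_d.+1 := row_mx (1%:M : 'M[R]_1) x.
have e0 x : e x ord0 ord0 = 1.
  have -> : (ord0 : 'I_d.+1) = lshift d (ord0 : 'I_1) by apply/val_inj.
  by apply: etrans (row_mxEl _ _ _ _) _; rewrite mxE eqxx.
have eS x j : e x ord0 (lift ord0 j) = x ord0 j.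
  have -> : lift ord0 j = rshift 1 j :> 'I_d.+1 by apply/val_inj.
  exact: row_mxEr.
have eD x : dom_persp (e x) by rewrite /dom_persp /= e0 ltr01.
have eK x : persp (e x) = x.
  by apply/rowP => j; rewrite mxE e0 eS divr1.
exists (fun x => persp (f (e x))); split; last first.
  by move=> F' HF'; apply/funext => x; rewrite -HF' // eK.
move=> s Ds; have s0 : s ord0 ord0 != 0 by rewrite gt_eqF.
have sE : e (persp s) = (s ord0 ord0)^-1 *: s.
  apply/rowP => i; rewrite [RHS]mxE; have [j ->|->] := unliftP ord0 i.
    by rewrite eS mxE mulrC.
  by rewrite e0 mulVf.
have [|mu mu0] := scf s (s ord0 ord0)^-1 Ds; first by rewrite invr_gt0.
rewrite -sE => ->; apply/rowP => j; rewrite !mxE.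
by rewrite -mulf_div divff ?gt_eqF// mul1r.
Qed.

End perspective.

Section trajectories.
Context {R : realType}.

(* The component m does not depend on i and is stored once. *)
Record trajectory (d : nat) (Omega : nat -> Type) := Trajectory {
  asset : nat -> 'rV[R]_d.+1 ;
  info : forall i, Omega i ;
  stage : nat }.

Context {d : nat} {Omega : nat -> Type}.
Implicit Types (S T : trajectory d Omega) (TS : set (trajectory d Omega)).

Definition traj_term T (i : nat) : 'rV[R]_d.+1 * Omega i * nat :=
  (asset T i, info T i, stage T).

Definition trajectory_set (Sigma : nat -> set 'rV[R]_d.+1) (Theta : set nat)
    (s0 : 'rV[R]_d.+1) (w0 : Omega 0%N) TS :=
  forall T, TS T ->
    [/\ forall i, Sigma i (asset T i), Theta (stage T),
        asset T 0%N = s0, info T 0%N = w0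
      & forall i, dom_persp (asset T i)].

Definition node_set TS S (k : nat) : set (trajectory d Omega) :=
  [set T | [/\ TS T, forall i, (i <= k)%N -> traj_term T i = traj_term S i
             & (k < stage T)%N]].

Definition arbitrage_free TS S (k : nat) :=
  relative_interior (convex_hull
    [set persp (asset T k.+1) - persp (asset S k) | T in node_set TS S k]) 0.

(* The index set is the node of the original trajectory set; in particular it
   does not grow when f identifies several histories. *)
Definition transformed_arbitrage_free {d' : nat}
    (f : 'rV[R]_d.+1 -> 'rV[R]_d'.+1) TS S (k : nat) :=
  relative_interior (convex_hull
    [set persp (f (asset T k.+1)) - persp (f (asset S k))
       | T in node_set TS S k]) 0.

End trajectories.
Arguments trajectory : clear implicits.

Definition no_arbitrage_symmetry {R : realType} {d d' : nat}
    (f : 'rV[R]_d.+1 -> 'rV[R]_d'.+1) :=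
  forall (Omega : nat -> Type) (Sigma : nat -> set 'rV[R]_d.+1)
    (Theta : set nat) (s0 : 'rV[R]_d.+1) (w0 : Omega 0%N)
    (TS : set (trajectory R d Omega)) (S : trajectory R d Omega) (k : nat),
  trajectory_set Sigma Theta s0 w0 TS -> TS S ->
  arbitrage_free TS S k -> transformed_arbitrage_free f TS S k.

(* Main.v *)
(* For a nonempty set B, the origin is in the relative interior of co(B) iff
   every b in B can be prolonged beyond the origin: -e b is in co(B) for some
   e > 0.  Indeed the vectors v such that t v stays in co(B) for all small t
   form a linear subspace, which then contains B, hence the affine hull of
   co(B); a finite basis of it yields a neighbourhood.  With B = A - p this
   says that every a in A is an end of an open segment through p whose other
   end c is in co(A).  Since F maps open segments into open segments, F(p) is
   in the open segment (F(a), F(c)), and F(c) is in co(F(A)) because the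
   preimage of co(F(A)) under F is convex. *)
Require Import Defs.
From HB Require Import structures.
From mathcomp Require Import all_boot all_order all_algebra.
From mathcomp Require Import all_classical all_reals all_analysis.
From mathcomp Require Import ring lra.
Set Implicit Arguments.
Unset Strict Implicit.
Unset Printing Implicit Defensive.
Import Order.TTheory GRing.Theory Num.Theory.
Import numFieldNormedType.Exports.
Local Open Scope classical_set_scope.
Local Open Scope ring_scope.

Lemma convex_setP (R : realType) n (A : set 'rV[R]_n) :
  convex_set A <-> forall x y (t : R), A x -> A y -> 0 < t < 1 ->
    A (t *: x + (1 - t) *: y).
Proof.
split=> [cA x y t Ax Ay /andP[t0 t1]|cA].
  have := cA x y (Itv01 (ltW t0) (ltW t1)).
  by rewrite !inE; apply.
apply/convex_setW => x y; rewrite !inE => Ax Ay t t0 t1; rewrite inE.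
by apply: cA => //; rewrite t0 t1.
Qed.

Lemma convex_hull_convex (R : realType) n (A : set 'rV[R]_n) :
  convex_set (convex_hull A).
Proof.
apply/convex_setP => x y t hx hy t01 B [cB AB].
move/convex_setP: (cB); apply => //; [exact: hx|exact: hy].
Qed.

(** Among the matrices whose row space lies in [D], take one of maximal rank. Adjoining a vector of
    [D] keeps the row space inside [D], so by maximality that vector was already there. *)
Lemma linear_subspace_row_space (R : realType) n (D : set 'rV[R]_n) :
  D 0 -> (forall u v, D u -> D v -> D (u + v)) ->
  (forall (a : R) v, D v -> D (a *: v)) ->
  exists M : 'M[R]_n, forall v, D v <-> (v <= M)%MS.
Proof.
move=> D0 DD DZ.
pose P r := `[< exists M : 'M[R]_n,
  (forall v : 'rV_n, (v <= M)%MS -> D v) /\ \rank M = r >].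
have P0 : exists r, P r.
  exists 0%N; apply/asboolP; exists 0; split; last exact: mxrank0.
  by move=> v; rewrite submx0 => /eqP ->.
have Pn r : P r -> (r <= n)%N.
  by move=> /asboolP[M [_ <-]]; exact: rank_leq_row.
have [r /asboolP[M [MD <-]] max_r] := ex_maxnP P0 Pn.
exists M => v; split=> [Dv|]; last exact: MD.
have MvD (u : 'rV_n) : (u <= M + v)%MS -> D u.
  move=> /sub_addsmxP[[w a] /= ->]; apply: DD.
    by apply: MD; exact: submxMl.
  by rewrite [a]mx11_scalar mul_scalar_mx; exact: DZ.
have rle : (\rank (M + v) <= \rank M)%N.
  by apply: max_r; apply/asboolP; exists (M + v)%MS.
have : (M + v <= M)%MS by rewrite -(geq_leqif (mxrank_leqif_sup (addsmxSl M v))).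
by apply: submx_trans; exact: addsmxSr.
Qed.

Lemma mulmx_coord_continuous (R : realType) m n (K : 'M[R]_(m, n)) i :
  continuous (fun y : 'rV[R]_m => (y *m K) ord0 i).
Proof.
move=> y; rewrite /continuous_at mxE.
under eq_fun do rewrite mxE.
apply: (@cvg_big R 'I_m +%R 0 predT (@add_continuous R) 'rV[R]_m (nbhs y)
  (index_enum _) (fun j z => z ord0 j * K j i)
  (fun j => y ord0 j * K j i) _) => j _.
by apply: cvgMr_tmp; exact: coord_continuous.
Qed.

Section relative_interior_at_0.
Context {R : realType} {n : nat}.
Implicit Types (C : set 'rV[R]_n) (u v : 'rV[R]_n).

(** Here [t] takes both signs, so that absorbed vectors are stable under negation and can form a
    linear subspace rather than a mere cone. *)
Definition absorbed C v := \forall t \near (0 : R), C (t *: v).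

Lemma absorbed0 C : C 0 -> absorbed C 0.
Proof.
by move=> C0; near=> t; rewrite scaler0.
Unshelve. all: by end_near. Qed.

Lemma absorbedD C u v : convex_set C ->
  absorbed C u -> absorbed C v -> absorbed C (u + v).
Proof.
move=> /convex_setP cC Cu Cv.
have c2 : (2 * t : R) @[t --> (0 : R)] --> (0 : R).
  rewrite -[X in _ --> X](mulr0 (2 : R)).
  by apply: cvgMl_tmp; exact: cvg_id.
move: (c2 _ Cu) (c2 _ Cv); rewrite /absorbed !near_simpl => Cu2 Cv2.
near=> t.
(* The midpoint of [2t u] and [2t v]. *)
have -> : t *: (u + v) = 2^-1 *: ((2 * t) *: u) + (1 - 2^-1) *: ((2 * t) *: v).
  by rewrite !scalerA scalerDr; congr (_ *: _ + _ *: _); field.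
by apply: cC; [near: t|near: t|lra].
Unshelve. all: by end_near. Qed.

Lemma absorbedZ C (a : R) v : absorbed C v -> absorbed C (a *: v).
Proof.
move=> Cv.
have ca : (t * a : R) @[t --> (0 : R)] --> (0 : R).
  rewrite -[X in _ --> X](mul0r a).
  by apply: cvgMr_tmp; exact: cvg_id.
have := ca _ Cv; rewrite near_simpl => Cav.
by near do rewrite scalerA; exact: Cav.
Unshelve. all: by end_near. Qed.

(* Halving the scale at each step of the induction on [r] avoids convex
   combinations of more than two points. *)
Lemma near_absorbed_sum C (T : Type) (F : set_system T) {FF : Filter F}
    (I : Type) (r : seq I) (c : I -> T -> R) (v : I -> 'rV[R]_n) :
  convex_set C -> C 0 -> (forall i, absorbed C (v i)) ->
  (forall i, c i x @[x --> F] --> (0 : R)) ->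
  \forall x \near F, C (\sum_(i <- r) c i x *: v i).
Proof.
move=> cC C0 Cv; elim: r c => [|i r IH] c c0.
  by near=> x; rewrite big_nil.
have c2 j : 2 * c j x @[x --> F] --> (0 : R).
  by rewrite -[X in _ --> X](mulr0 (2 : R)); apply: cvgMl_tmp; exact: c0.
have Ci := c2 i _ (Cv i); rewrite near_simpl in Ci.
have Cr := IH _ c2.
near=> x.
have -> : \sum_(j <- i :: r) c j x *: v j =
    2^-1 *: ((2 * c i x) *: v i)
      + (1 - 2^-1) *: \sum_(j <- r) (2 * c j x) *: v j.
  rewrite big_cons scaler_sumr scalerA; congr (_ *: _ + _); first by field.
  by apply: eq_bigr => j _; rewrite scalerA; congr (_ *: _); field.
by move/convex_setP: cC; apply; [near: x|near: x|lra].
Unshelve. all: by end_near. Qed.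

Lemma relative_interior0P C : convex_set C ->
  relative_interior C 0 <-> C 0 /\ (forall v, C v -> absorbed C v).
Proof.
move=> cC; split=> [[aff0 nC]|[C0 CA]].
  have C0 : C 0 by exact: (nbhs_singleton nC).
  split=> // v Cv.
  have cv : t *: v @[t --> (0 : R)] --> (0 : 'rV[R]_n).
    rewrite -[X in _ --> X](scale0r v).
    by apply: cvgZr_tmp; exact: cvg_id.
  have {}nC : \forall t \near (0 : R), affine_hull C (t *: v) -> C (t *: v).
    exact: cv nC.
  apply: filterS nC => t; apply.
  (* [t v] lies on the line through [v] and the origin, both in [C]. *)
  move=> B [aB CB]; rewrite -[t *: v]addr0 -(scaler0 _ (1 - t)).
  by apply: aB; exact: CB.
have [M DM] := linear_subspace_row_space (absorbed0 C0)
  (fun u v => @absorbedD C u v cC) (@absorbedZ C).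
split; first by move=> B [_ CB]; exact: CB.
have affM : affine_hull C `<=` [set v | (v <= M)%MS].
  apply: smallest_sub => [x y t /= xM yM|v Cv]; last exact/DM/CA.
  by rewrite addmx_sub// scalemx_sub.
(* Coordinates of [y] along the rows of [M], valid when [y] is in the row space. They are linear in
   [y], hence small near the origin, and the rows are absorbed. *)
pose c i (y : 'rV[R]_n) := (y *m pinvmx M) ord0 i.
have c0 i : c i y @[y --> (0 : 'rV[R]_n)] --> (0 : R).
  have := @mulmx_coord_continuous R n n (pinvmx M) i 0.
  by rewrite /continuous_at mul0mx mxE.
have DMi i : absorbed C (row i M) by apply/DM; exact: row_sub.
have nC := near_absorbed_sum (F := nbhs (0 : 'rV[R]_n)) (index_enum _)
  cC C0 DMi c0.
near=> y => /affM /= yM.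
by rewrite -(mulmxKpV yM) mulmx_sum_row; near: y; exact: nC.
Unshelve. all: by end_near. Qed.

Lemma relative_interior_convex_hull0P (B : set 'rV[R]_n) :
  relative_interior (convex_hull B) 0 <->
  B !=set0 /\
    forall b, B b -> exists2 e : R, 0 < e & convex_hull B (- e *: b).
Proof.
have cC := @convex_hull_convex R n B.
have BC : B `<=` convex_hull B by exact: sub_gen_smallest.
split=> [/(relative_interior0P cC)[C0 CA]|[[b0 Bb0] Be]].
  split=> [|b Bb].
    apply/set0P/eqP => B0; move: C0; rewrite B0.
    by move=> /(_ set0); apply; split => //; apply/convex_setP.
  have /nbhs_ballP[e /= e0 Ce] := CA b (BC b Bb).
  exists (e / 2); first by rewrite divr_gt0.
  apply: Ce; rewrite -ball_normE /= sub0r opprK gtr0_norm; lra.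
have Babs b : B b -> absorbed (convex_hull B) b.
  move=> Bb; have [e e0 Ce] := Be b Bb.
  near=> t.
  have te : - e < t by near: t; apply: lt_nbhsr; rewrite oppr_lt0.
  have t1 : t < 1 by near: t; apply: lt_nbhsl.
  have e1 : 0 < 1 + e by rewrite addr_gt0.
  (* This weight of [b] against [- e b] is in (0, 1) exactly when [- e < t < 1]. *)
  have -> : t *: b = ((t + e) / (1 + e)) *: b
                     + (1 - (t + e) / (1 + e)) *: (- e *: b).
    by rewrite scalerA -scalerDl; congr (_ *: _); field; lra.
  move/convex_setP: cC; apply; [exact: BC|exact: Ce|].
  by rewrite ltr_pdivlMr// ltr_pdivrMr//; lra.
have C0 : convex_hull B 0.
  by have := nbhs_singleton (Babs _ Bb0); rewrite scale0r.
apply/(relative_interior0P cC); split => //.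
(* The absorbed vectors form a convex set containing [B], hence contain its hull. *)
apply: smallest_sub => //; apply/convex_setP => x y t Dx Dy _.
by apply: absorbedD => //; exact: absorbedZ.
Unshelve. all: by end_near. Qed.

End relative_interior_at_0.

Lemma relative_interior_inversely_convexity_preserving (R : realType)
    (d d' : nat) (F : 'rV[R]_d -> 'rV[R]_d') (A : set 'rV[R]_d) p :
  strict_inversely_convexity_preserving setT F ->
  relative_interior (convex_hull [set a - p | a in A]) 0 ->
  relative_interior (convex_hull [set F a - F p | a in A]) 0.
Proof.
move=> hF /relative_interior_convex_hull0P[[_ [a0 Aa0 _]] Ae].
apply/relative_interior_convex_hull0P; split; first by exists (F a0 - F p), a0.
set B := [set F a - F p | a in A].
have cB := @convex_hull_convex R d' B; move/convex_setP: (cB) => cB'.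
have hullF :
    convex_hull [set a - p | a in A] `<=`
    [set v | convex_hull B (F (v + p) - F p)].
  apply: smallest_sub => [|_ [a Aa <-]]; last first.
    by rewrite /= subrK; apply: sub_gen_smallest; exists a.
  apply/convex_setP => x y t /= Bx By t01.
  (* The weight [s] in the image may differ from [t]; only its lying in (0, 1) matters for the
     convexity of the preimage. *)
  have [|s s01 Fs] := hF (x + p) (y + p) I I (F (t *: x + (1 - t) *: y + p)).
    exists (t *: x + (1 - t) *: y + p) => //; exists t => //=.
    by rewrite !scalerDr addrACA -scalerDl [t + _]addrC subrK scale1r.
  have := cB' _ _ s Bx By s01; congr (convex_hull _ _).
  rewrite -Fs !scalerBr addrACA -opprD -scalerDl.
  by rewrite [s + _]addrC subrK scale1r.
move=> _ [a Aa <-].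
have [|e e0 /hullF /= Bc] := Ae (a - p); first by exists a.
have e1 : 0 < 1 + e by rewrite addr_gt0.
have [|s /= /andP[s0 s1] Fs] := hF a (- e *: (a - p) + p) I I (F p).
  (* With [c = p - e (a - p)], solving [p = l a + (1 - l) c] gives [l = e / (1 + e)]. *)
  exists p => //; exists (e / (1 + e)) => /=.
    by rewrite ltr_pdivlMr// ltr_pdivrMr//; lra.
  by apply/rowP => i; rewrite !mxE; field; lra.
(* From [F p = s F a + (1 - s) F c] follows [F c - F p = - (s / (1 - s)) (F a - F p)]. *)
exists (s / (1 - s)); first by rewrite divr_gt0// subr_gt0.
have s1' : 1 - s != 0 by rewrite subr_eq0 gt_eqF.
move: Bc; congr (convex_hull _ _).
apply: (scalerI s1'); rewrite -{1 2}Fs.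
apply/rowP => i; rewrite !mxE; field.
exact: s1'.
Qed.

Theorem theorem4 (R : realType) (d d' : nat) (hd : (1 <= d)%N) (hd' : (1 <= d')%N)
    (f : 'rV[R]_d.+1 -> 'rV[R]_d'.+1) (F : 'rV[R]_d -> 'rV[R]_d')
    (hf : forall s, dom_persp s -> dom_persp (f s))
    (hscal : scaling_condition f)
    (hF : induces f F)
    (hconv : strict_inversely_convexity_preserving setT F) :
  (forall (Omega : nat -> Type) (Sigma : nat -> set 'rV[R]_d.+1)
      (Theta : set nat) (s0 : 'rV[R]_d.+1) (w0 : Omega 0%N)
      (TS : set (trajectory R d Omega)) (S : trajectory R d Omega) (k : nat),
    trajectory_set Sigma Theta s0 w0 TS -> TS S ->
    arbitrage_free TS S k ->
    relative_interior (convex_hull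
      [set persp (f (asset T k.+1)) - persp (f (asset S k))
         | T in node_set TS S k]) 0)
  /\ no_arbitrage_symmetry f.
Proof.
suff h : no_arbitrage_symmetry f by split.
move=> Omega Sigma Theta s0 w0 TS S k hTS TSS hS.
have dom T i : TS T -> dom_persp (asset T i) by move=> /hTS[].
rewrite /transformed_arbitrage_free -(hF _ (dom S k TSS)).
(* Used with [G = id] for the hypothesis and [G = F] for the goal, so that both refer to the same
   set of successor prices. *)
have imE d1 (G : 'rV[R]_d -> 'rV[R]_d1) :
    [set G (persp (asset T k.+1)) - G (persp (asset S k))
       | T in node_set TS S k] =
    [set G a - G (persp (asset S k))
       | a in [set persp (asset T k.+1) | T in node_set TS S k]].
  by rewrite image_comp.
have := relative_interior_inversely_convexity_preserving hconv
  (A := [set persp (asset T k.+1) | T in node_set TS S k])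
  (p := persp (asset S k)).
rewrite -(imE _ F) -(imE _ id) => /(_ hS).
congr (relative_interior (convex_hull _) 0).
by apply: eq_imagel => T [TST _ _]; rewrite hF//; exact: dom.
Qed.
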